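(* Let $w\in S_n$ and $\alpha\in\mathbb{Z}_{\geq 0}^n$, and let $c_{\alpha,w}$ be the coefficient of $x^\alpha$ in the Schubert polynomial $\mathfrak{S}_w$. Then $$c_{\alpha,w}>0\iff \mathsf{PerfectTab}(D(w),\alpha)\neq\emptyset\iff \mathsf{PerfectTab}_{\downarrow}(D(w),\alpha)\neq\emptyset,$$ where $D(w)$ is the Rothe diagram of $w$.
   Context: Schubert polynomials: for $w_0=n\,(n-1)\cdots 2\,1\in S_n$ set $\mathfrak{S}_{w_0}=x_1^{n-1}x_2^{n-2}\cdots x_{n-1}$. If $w\in S_n$, $w\neq w_0$, choose $i$ with $w(i)<w(i+1)$ and set $\mathfrak{S}_w=\partial_i\mathfrak{S}_{ws_i}$, where $s_i$ is the transposition swapping $i$ and $i+1$ and $\partial_i f=\frac{f(\dots,x_i,x_{i+1},\dots)-f(\dots,x_{i+1},x_i,\dots)}{x_i-x_{i+1}}$ (this is well defined). Write $\mathfrak{S}_w=\sum_{\alpha\in\mathbb{Z}_{\ge0}^n}c_{\alpha,w}x^\alpha$. Rothe diagram: $D(w)=\{(i,j):1\le i,j\le n,\ j<w(i),\ i<w^{-1}(j)\}\subseteq[n]^2$, where $(r,c)$ denotes the box in row $r$ (from the top) and column $c$ (from the left). For $D\subseteq[n]^2$ and $\alpha\in\mathbb{Z}_{\ge0}^n$, $\mathsf{PerfectTab}(D,\alpha)$ is the set of fillings of the boxes of $D$ with entries in $[n]$, each box containing exactly one entry, such that exactly $\alpha_k$ entries equal $k$ for each $k$, the entries in each column are distinct,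 and every entry in row $i$ is $\le i$. $\mathsf{PerfectTab}_{\downarrow}(D,\alpha)\subseteq\mathsf{PerfectTab}(D,\alpha)$ is the subset of fillings in which the entries of each column strictly increase from top to bottom. *)

(* Defs.v *)
From HB Require Import structures.
From mathcomp Require Import all_boot all_order all_fingroup all_algebra.
From mathcomp Require Import zify ring.
From mathcomp Require Import mpoly.

Set Implicit Arguments.
Unset Strict Implicit.
Unset Printing Implicit Defensive.

Import Order.TTheory GRing.Theory Num.Theory.
Local Open Scope ring_scope.

(* Rows, columns, entries, variables and the points permuted by 'S_n are all  *)
(* indexed by 'I_n, so k : 'I_n stands for the integer k + 1 of [n].          *)

Section DividedDifference.
Variable n : nat.
Implicit Types (i j k : 'I_n) (f g : {mpoly int[n]}).

Fact divdiff_subproof i j f :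
  exists g, g * ('X_i - 'X_j) == f - msym (tperm i j) f.
Proof.
pose P f := exists g, g * ('X_i - 'X_j) = f - msym (tperm i j) f.
suff [g Eg] : P f by exists g; apply/eqP.
have PD f1 f2 : P f1 -> P f2 -> P (f1 + f2).
  by move=> [g1 E1] [g2 E2]; exists (g1 + g2); rewrite msymD mulrDl E1 E2; ring.
have PZ c f1 : P f1 -> P (c *: f1).
  by move=> [g1 E1]; exists (c *: g1); rewrite msymZ -scalerAl E1 scalerBr.
have PM f1 f2 : P f1 -> P f2 -> P (f1 * f2).
  move=> [g1 E1] [g2 E2]; exists (g1 * f2 + msym (tperm i j) f1 * g2).
  by rewrite msymM mulrDl -[_ * g2 * _]mulrA E2 mulrAC E1; ring.
have P1 : P 1 by exists 0; rewrite msym1 mul0r subrr.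
have PX k : P 'X_k.
  have -> : P 'X_k = (exists g, g * ('X_i - 'X_j) = 'X_k - 'X_(tperm i j k)).
    by rewrite /P /msym mmapX mmap1U.
  case: tpermP => [->|->|_ _]; first by exists 1; rewrite mul1r.
    by exists (-1); ring.
  by exists 0; rewrite mul0r subrr.
elim/mpolyind: f => [|c m p _ _ Pp]; first by exists 0; rewrite msym0 mul0r subrr.
apply/PD/Pp/PZ; rewrite mpolyXE_id.
apply: (big_ind P) => // k _.
by elim: (m k) => [|d IHd]; rewrite ?expr0 // exprS; apply: PM.
Qed.

(* The quotient (f - s_ij f) / (x_i - x_j), which is unique when i != j since *)
(* {mpoly int[n]} is an integral domain.                                      *)
Definition divdiff i j f : {mpoly int[n]} := xchoose (divdiff_subproof i j f).

Lemma divdiffE i j f : divdiff i j f * ('X_i - 'X_j) = f - msym (tperm i j) f.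
Proof. exact/eqP/(xchooseP (divdiff_subproof i j f)). Qed.

End DividedDifference.

Section Schubert.
Variable n : nat.
Implicit Types (w : 'S_n) (i j k : 'I_n).

Definition w0 : 'S_n := perm (@rev_ord_inj n).

Definition ascent w (p : 'I_n * 'I_n) : bool :=
  (p.2 == p.1.+1 :> nat) && (w p.1 < w p.2)%N.

(* The number of non-inversions, i.e. n(n-1)/2 minus the length of w: this    *)
(* is the number of divided differences separating w from w0.                 *)
Definition colength w : nat :=
  #|[set p : 'I_n * 'I_n | (p.1 < p.2)%N && (w p.1 < w p.2)%N]|.

(* Products in 'S_n compose from left to right, (s * t) x = t (s x), so that  *)
(* the permutation w s_i of the usual convention is (tperm i i+1 * w)%g.      *)
Fixpoint schubert_rec (m : nat) w : {mpoly int[n]} :=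
  if w == w0 then 'X_[[multinom (n - i.+1)%N | i < n]] else
  if m is m'.+1 then
    if [pick p | ascent w p] is Some p then
      divdiff p.1 p.2 (schubert_rec m' (tperm p.1 p.2 * w)%g)
    else 0
  else 0.

Definition schubert w : {mpoly int[n]} := schubert_rec (colength w) w.

End Schubert.
Arguments w0 {n}.

(* The junk values 0 of schubert_rec are never reached, and the result does   *)
(* not depend on the ascents picked: see schubert_w0, ex_ascent and           *)
(* schubert_ascent.                                                           *)

(* Ring identities are proved over an abstract ring because the ring tactic   *)
(* is very slow on terms with msym, a ring morphism.                          *)
Fact braid_ring1 (R : comNzRingType) (x y z f1 f2 f3 f4 f5 f6 g gt gts h hs : R) :
  g * (x - y) = f1 - f2 -> h * (y - z) = g - gt -> hs * (x - z) = g - gts ->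
  gt * (x - z) = f3 - f4 -> gts * (y - z) = f5 - f6 ->
  (h - hs) * (y - z) * (x - z) = f1 - f2 - f3 + f4 + f5 - f6.
Proof.
move=> Eg Eh Eth Etg Estg.
transitivity (h * (y - z) * (x - z) - hs * (x - z) * (y - z)); first by ring.
rewrite Eh Eth.
transitivity (g * (x - y) - gt * (x - z) + gts * (y - z)); first by ring.
by rewrite Eg Etg Estg; ring.
Qed.

Fact braid_ring2 (R : comNzRingType) (x y z k f1 f2 f3 f4 f5 f6 : R) :
  - k * (z - y) * (y - x) * (z - x) = f1 - f2 - f3 + f4 + f5 - f6 ->
  k * (x - y) * (y - z) * (x - z) = f1 - f2 - f3 + f4 + f5 - f6.
Proof. by move=> <-; ring. Qed.

Fact alt4 (R : comNzRingType) (a b c d : R) : a - c - (b - d) = a - b - c + d.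
Proof. by ring. Qed.

Fact alt6 (R : comNzRingType) (a b c d e f : R) :
  a - b - c + d + e - f = a - c - b + e + d - f.
Proof. by ring. Qed.

Section SchubertTheory.
Variable n : nat.
Implicit Types (w : 'S_n) (i j k l : 'I_n) (f g h : {mpoly int[n]}).

Lemma ascent_w0 p : ~~ ascent (@w0 n) p.
Proof.
case: p => i j; rewrite /ascent /= !permE /=; have := ltn_ord j; lia.
Qed.

Lemma ex_ascent w : w != w0 -> exists p, ascent w p.
Proof.
move=> neq_w; case: (pickP (ascent w)) => [p Hp|noasc]; first by exists p.
case/eqP: neq_w.
have dec i j : j = i.+1 :> nat -> (w j < w i)%N.
  move=> Ej; have := noasc (i, j); rewrite /ascent /= Ej eqxx /=.
  move/negbT; rewrite -leqNgt leq_eqVlt => /orP[/eqP E|//].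
  by move/val_inj/perm_inj: E Ej => -> /eqP; rewrite -[X in X == _]addn0 -addn1 eqn_add2l.
have le m i : i = m :> nat -> (w i <= rev_ord i)%N.
  elim: m i => [|m IHm] i Ei /=; first by have := ltn_ord (w i); lia.
  have ltm : (m < n)%N by have := ltn_ord i; lia.
  have := IHm (Ordinal ltm) erefl; have := @dec (Ordinal ltm) i Ei => /=; lia.
have leif i : true -> (w i <= rev_ord i ?= iff (w i == rev_ord i :> nat))%N.
  by move=> _; split; [exact: (le i)|].
have [_] := leqif_sum leif.
have Ew : (\sum_(i < n) i = \sum_(i < n) w i)%N.
  exact: (reindex_inj (@perm_inj _ w)).
have Er : (\sum_(i < n) i = \sum_(i < n) rev_ord i)%N.
  exact: (reindex_inj (@rev_ord_inj n)).
rewrite -Ew -Er eqxx => /esym/forallP H.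
by apply/permP => i; rewrite permE; apply/val_inj/eqP/(H i).
Qed.

Lemma colength_ascent w p :
  ascent w p -> (colength (tperm p.1 p.2 * w)%g < colength w)%N.
Proof.
case: p => i j /andP[/= /eqP Ej Hw]; rewrite /colength.
set s := tperm i j; pose F (q : 'I_n * 'I_n) := (s q.1, s q.2).
have injF : injective F.
  by case=> [a b] [c d]; rewrite /F /= => -[/perm_inj -> /perm_inj ->].
rewrite -[X in (X < _)%N](card_imset _ injF); apply/proper_card/properP; split.
  apply/subsetP => _ /imsetP[[a b] + ->]; rewrite !inE /= !permM => /andP[lt_ab lt_w].
  rewrite lt_w andbT; move: lt_w; rewrite /s.
  case: (tpermP i j a) => [Ea|Ea|/eqP na1 /eqP na2];
  case: (tpermP i j b) => [Eb|Eb|/eqP nb1 /eqP nb2]; subst; rewrite ?ltnn //;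
  move: lt_ab Hw; try move: na1 na2; try move: nb1 nb2;
  rewrite -?val_eqE /= ?Ej; try lia.
exists (i, j); first by rewrite inE /= Ej ltnSn.
apply/negP => /imsetP[[a b]]; rewrite inE /= => /andP[lt_ab _] [Ei Ejj].
move: lt_ab; rewrite -(tpermK i j a) -(tpermK i j b) -/s -Ei -Ejj tpermL tpermR.
by rewrite Ej ltnNge leqnSn.
Qed.

Lemma schubert_w0 : schubert w0 = 'X_[[multinom (n - i.+1)%N | i < n]].
Proof. by rewrite /schubert; case: (colength _) => /=; rewrite eqxx. Qed.

Lemma ascent_neq w p : ascent w p -> (w == w0) = false.
Proof. by apply: contraTF => /eqP->; apply: ascent_w0. Qed.

Lemma schubert_rec_fuel m1 m2 w :
  (colength w <= m1)%N -> (colength w <= m2)%N ->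
  schubert_rec m1 w = schubert_rec m2 w.
Proof.
elim: m1 m2 w => [|m1 IH] [|m2] w le1 le2; rewrite /=; case: eqP => [//|_].
- by [].
- by case: pickP => [p /colength_ascent/leq_trans/(_ le1)|].
- by case: pickP => [p /colength_ascent/leq_trans/(_ le2)|].
case: pickP => [p /colength_ascent lt|//].
by rewrite (IH m2) // -ltnS ?(leq_trans lt le1) ?(leq_trans lt le2).
Qed.

Lemma schubert_pick w p0 : ascent w p0 ->
  exists2 p, ascent w p & schubert w = divdiff p.1 p.2 (schubert (tperm p.1 p.2 * w)%g).
Proof.
move=> Hp0; rewrite {1}/schubert.
have := colength_ascent Hp0; case E: (colength w) => [//|m] _; rewrite /=.
rewrite (ascent_neq Hp0); case: pickP => [p Hp|]; last by move/(_ p0); rewrite Hp0.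
exists p; first exact: Hp.
rewrite /schubert; congr divdiff; apply: schubert_rec_fuel; last exact: leqnn.
by have := colength_ascent Hp; rewrite E.
Qed.

Local Notation A i j f := (msym (tperm i j) f).

Lemma divdiff_neq0 i j : i != j -> 'X_i - 'X_j != 0 :> {mpoly int[n]}.
Proof.
move=> neq; rewrite subr_eq0; apply: contraNneq neq => E.
have := congr1 (mcoeff U_(i)%MM) E; rewrite !mcoeffXU eqxx eq_sym.
by case: (i == j).
Qed.

Let AX i j k : A i j ('X_k : {mpoly int[n]}) = 'X_(tperm i j k).
Proof. by rewrite /msym mmapX mmap1U. Qed.

Let AK i j f : A i j (A i j f) = f.
Proof. by rewrite -msymMm tperm2 msym1m. Qed.

Let A_divdiff i j f : i != j -> A i j (divdiff i j f) = divdiff i j f.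
Proof.
move=> neq; apply: (mulIf (divdiff_neq0 neq)).
have := congr1 (msym (tperm i j)) (divdiffE i j f).
rewrite msymM !msymB !AX tpermL tpermR AK => E.
by rewrite divdiffE -[RHS]opprB -E -mulrN opprB.
Qed.

Lemma divdiffC i j k l f : i != j -> k != l ->
    [&& i != k, i != l, j != k & j != l] ->
  divdiff i j (divdiff k l f) = divdiff k l (divdiff i j f).
Proof.
move=> ij kl /and4P[ik il jk jl].
have E a b c d : a != b -> c != d -> [&& a != c, a != d, b != c & b != d] ->
  divdiff a b (divdiff c d f) * ('X_a - 'X_b) * ('X_c - 'X_d)
    = f - A a b f - A c d f + A a b (A c d f).
  move=> ab cd /and4P[ac ad bc bd]; rewrite divdiffE mulrBl divdiffE.
  have := congr1 (msym (tperm a b)) (divdiffE c d f); rewrite msymM !msymB.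
  by rewrite !AX !tpermD // => ->; apply: alt4.
have E1 : _ := E i j k l ij kl; have E2 : _ := E k l i j kl ij.
rewrite ik il jk jl in E1; have {}E1 := E1 isT.
rewrite ![k == _]eq_sym ![l == _]eq_sym ik il jk jl in E2; have {}E2 := E2 isT.
have comm : A k l (A i j f) = A i j (A k l f).
  rewrite -!msymMm; congr (msym _ f).
  by rewrite conjgC tpermJ !tpermD // eq_sym.
apply: (mulIf (divdiff_neq0 ij)); apply: (mulIf (divdiff_neq0 kl)).
by rewrite [LHS]E1 [RHS]mulrAC [RHS]E2 comm [f - _ - _]addrAC.
Qed.

Let tperm_braid i j k : i != j -> j != k -> i != k ->
  (tperm i j * tperm j k * tperm i j = tperm j k * tperm i j * tperm j k)%g.
Proof.
move=> ij jk ik; rewrite -!mulgA [(tperm j k * tperm i j)%g]conjgC.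
rewrite [(tperm i j * tperm j k)%g]conjgC !tpermJ !mulgA !tperm2 !mul1g.
by rewrite tpermR tpermL !tpermD // eq_sym.
Qed.

Let braid_expand i j k f : i != j -> j != k -> i != k ->
  divdiff i j (divdiff j k (divdiff i j f))
      * ('X_i - 'X_j) * ('X_j - 'X_k) * ('X_i - 'X_k)
  = f - A i j f - A j k f + A j k (A i j f) + A i j (A j k f)
    - A i j (A j k (A i j f)).
Proof.
move=> ij jk ik; set g := divdiff i j f; set h := divdiff j k g.
have Eg : g * ('X_i - 'X_j) = f - A i j f by exact: divdiffE.
have Eh : h * ('X_j - 'X_k) = g - A j k g by exact: divdiffE.
have Eth : A i j h * ('X_i - 'X_k) = g - A i j (A j k g).
  have := congr1 (msym (tperm i j)) Eh; rewrite msymM !msymB !AX tpermR.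
  by rewrite tpermD // => ->; rewrite A_divdiff.
have Etg : A j k g * ('X_i - 'X_k) = A j k f - A j k (A i j f).
  have := congr1 (msym (tperm j k)) Eg; rewrite msymM !msymB !AX tpermL.
  by rewrite tpermD 1?eq_sym // => ->.
have Estg : A i j (A j k g) * ('X_j - 'X_k) = A i j (A j k f) - A i j (A j k (A i j f)).
  have := congr1 (msym (tperm i j)) Etg; rewrite msymM !msymB !AX tpermL.
  by rewrite tpermD // => ->.
rewrite divdiffE; exact: braid_ring1 Eg Eh Eth Etg Estg.
Qed.

Let divdiff_opp i j f : i != j -> divdiff i j (- f) = - divdiff i j f.
Proof.
move=> neq; apply: (mulIf (divdiff_neq0 neq)).
by rewrite mulNr !divdiffE msymN opprB opprK addrC.
Qed.

Let divdiff_swap i j f : i != j -> divdiff j i f = - divdiff i j f.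
Proof.
move=> neq; apply: (mulIf (divdiff_neq0 neq)).
by rewrite mulNr [in RHS]divdiffE -[X in _ * X]opprB mulrN divdiffE tpermC.
Qed.

Lemma divdiff_braid i j k f : i != j -> j != k -> i != k ->
  divdiff i j (divdiff j k (divdiff i j f))
    = divdiff j k (divdiff i j (divdiff j k f)).
Proof.
move=> ij jk ik; have E1 := braid_expand f ij jk ik.
have kj : k != j by rewrite eq_sym.
have ji : j != i by rewrite eq_sym.
have ki : k != i by rewrite eq_sym.
have E2 := braid_expand f kj ji ki.
rewrite (divdiff_swap f jk) (divdiff_swap (- _) ij) (divdiff_opp _ ij) opprK in E2.
rewrite (divdiff_swap (divdiff i j _) jk) in E2.
rewrite [tperm k j]tpermC [tperm j i]tpermC in E2.
have {}E2 := braid_ring2 E2.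
have braid : A i j (A j k (A i j f)) = A j k (A i j (A j k f)).
  by rewrite -!msymMm; congr (msym _ f); rewrite !mulgA; apply: tperm_braid.
apply: (mulIf (divdiff_neq0 ij)); apply: (mulIf (divdiff_neq0 jk)).
apply: (mulIf (divdiff_neq0 ik)); rewrite [LHS]E1 [RHS]E2 braid.
exact: alt6.
Qed.

Local Opaque schubert divdiff.

Theorem schubert_ascent w i j : j = i.+1 :> nat -> (w i < w j)%N ->
  schubert w = divdiff i j (schubert (tperm i j * w)%g).
Proof.
move: {-2}w (ltnSn (colength w)) i j => v.
elim: (colength w).+1 v => // m IHm {}w lew.
have IH v : (colength v < colength w)%N ->
    forall i j, j = i.+1 :> nat -> (v i < v j)%N ->
    schubert v = divdiff i j (schubert (tperm i j * v)%g).
  by move=> lt_v; apply: IHm; lia.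
have diamond i j k l : j = i.+1 :> nat -> l = k.+1 :> nat -> (i < k)%N ->
    (w i < w j)%N -> (w k < w l)%N ->
  divdiff i j (schubert (tperm i j * w)%g) = divdiff k l (schubert (tperm k l * w)%g).
  move=> Ej El ltik wij wkl.
  have asc1 : ascent w (i, j) by rewrite /ascent /= Ej eqxx.
  have asc2 : ascent w (k, l) by rewrite /ascent /= El eqxx.
  have ij : i != j by rewrite -val_eqE /=; lia.
  have kl : k != l by rewrite -val_eqE /=; lia.
  have ik : i != k by rewrite -val_eqE /=; lia.
  have il : i != l by rewrite -val_eqE /=; lia.
  have jl : j != l by rewrite -val_eqE /=; lia.
  case: (eqVneq j k) => [Ejk|jk].
    subst k; have ji : j != i by rewrite eq_sym.
    have lj : l != j by rewrite eq_sym.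
    have li : l != i by rewrite eq_sym.
    pose v1 := (tperm i j * w)%g; pose v2 := (tperm j l * v1)%g.
    pose u1 := (tperm j l * w)%g; pose u2 := (tperm i j * u1)%g.
    have [v1i v1j v1l] : [/\ v1 i = w j, v1 j = w i & v1 l = w l].
      by rewrite ![v1 _](permM _ w) tpermL tpermR tpermD.
    have [v2i v2j v2l] : [/\ v2 i = w j, v2 j = w l & v2 l = w i].
      by rewrite ![v2 _](permM _ v1) tpermL tpermR tpermD // v1i v1j v1l.
    have [u1i u1j u1l] : [/\ u1 i = w i, u1 j = w l & u1 l = w j].
      by rewrite ![u1 _](permM _ w) tpermL tpermR tpermD.
    have [u2i u2j u2l] : [/\ u2 i = w l, u2 j = w i & u2 l = w j].
      by rewrite ![u2 _](permM _ u1) tpermL tpermR tpermD // u1i u1j u1l.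
    have wil : (w i < w l)%N by apply: ltn_trans wkl.
    have lt_v1 : (colength v1 < colength w)%N := colength_ascent asc1.
    have lt_u1 : (colength u1 < colength w)%N := colength_ascent asc2.
    have lt_v2 : (colength v2 < colength v1)%N.
      by apply: (@colength_ascent v1 (j, l)); rewrite /ascent /= El eqxx v1j v1l.
    have lt_u2 : (colength u2 < colength u1)%N.
      by apply: (@colength_ascent u1 (i, j)); rewrite /ascent /= Ej eqxx u1i u1j.
    have e1 : schubert v1 = divdiff j l (schubert v2).
      by apply: (IH v1 lt_v1 j l El); rewrite v1j v1l.
    have e2 : schubert v2 = divdiff i j (schubert (tperm i j * v2)%g).
      by apply: (IH v2 (ltn_trans lt_v2 lt_v1) i j Ej); rewrite v2i v2j.
    have e3 : schubert u1 = divdiff i j (schubert u2).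
      by apply: (IH u1 lt_u1 i j Ej); rewrite u1i u1j.
    have e4 : schubert u2 = divdiff j l (schubert (tperm j l * u2)%g).
      by apply: (IH u2 (ltn_trans lt_u2 lt_u1) j l El); rewrite u2j u2l.
    have e5 : (tperm i j * v2 = tperm j l * u2)%g.
      by rewrite /v2 /u2 /v1 /u1 !mulgA; congr (_ * w)%g; apply: tperm_braid.
    rewrite [schubert _]e1 e2 e5 [X in _ = divdiff j l X]e3 e4.
    exact: divdiff_braid.
  have ki : k != i by rewrite eq_sym.
  have kj : k != j by rewrite eq_sym.
  have li : l != i by rewrite eq_sym.
  have lj : l != j by rewrite eq_sym.
  have e1 : schubert (tperm i j * w)%g = divdiff k l (schubert (tperm k l * (tperm i j * w))%g).
    by apply: (IH _ (colength_ascent asc1) k l El); rewrite /= !permM !tpermD.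
  have e2 : schubert (tperm k l * w)%g = divdiff i j (schubert (tperm i j * (tperm k l * w))%g).
    by apply: (IH _ (colength_ascent asc2) i j Ej); rewrite /= !permM !tpermD.
  have e3 : (tperm k l * (tperm i j * w) = tperm i j * (tperm k l * w))%g.
    by rewrite !mulgA; congr (_ * _)%g; rewrite conjgC tpermJ !tpermD.
  by rewrite e1 e3 e2; apply: divdiffC => //; rewrite ik il jk jl.
move=> i j Ej wij.
have asc : ascent w (i, j) by rewrite /ascent /= Ej eqxx.
have [[k l] /andP[/= /eqP El wkl] ->] := schubert_pick asc.
have [lt|lt|/val_inj Eik] := ltngtP i k; first by rewrite (@diamond i j k l).
  by rewrite (@diamond k l i j).
by subst k; have -> : l = j by apply: val_inj; rewrite /= El Ej.
Qed.

End SchubertTheory.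

Section Tableaux.
Variable n : nat.

Definition rothe (w : 'S_n) : {set 'I_n * 'I_n} :=
  [set b : 'I_n * 'I_n | (b.2 < w b.1)%N && (b.1 < (w^-1)%g b.2)%N].

Variable D : {set 'I_n * 'I_n}.

Definition box : finType := {b : 'I_n * 'I_n | b \in D}.
Definition brow (b : box) : 'I_n := (val b).1.
Definition bcol (b : box) : 'I_n := (val b).2.

Definition PerfectTab (alpha : 'X_{1..n}) : {set {ffun box -> 'I_n}} :=
  [set T : {ffun box -> 'I_n} |
    [&& [forall k, #|[set b | T b == k]| == alpha k],
        [forall b, forall b', (bcol b == bcol b') && (b != b') ==> (T b != T b')]
      & [forall b, (T b <= brow b)%N]]].

Definition PerfectTab_down (alpha : 'X_{1..n}) : {set {ffun box -> 'I_n}} :=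
  [set T in PerfectTab alpha |
    [forall b, forall b',
      (bcol b == bcol b') && (brow b < brow b')%N ==> (T b < T b')%N]].

End Tableaux.

(* Main.v *)
(* The Fomin-Stanley product in the nilCoxeter algebra (indices from 0),      *)
(*   prod_N (1 + x_N u_(n-1)) ... (1 + x_N u_N),                              *)
(* has nonnegative coefficients and satisfies the divided difference          *)
(* recursion, so its coefficient at [w] is the Schubert polynomial of [w] up  *)
(* to a positive factor independent of [w]. Stopping the product after        *)
(* [1 + x_N u_m], the exponents occurring at [w] are exactly the contents of  *)
(* the column-injective fillings of the Rothe diagram whose rows obey a flag  *)
(* depending on [(N, m)]: at a descent [m] of [w], erasing one label [N] and  *)
(* swapping rows [m] and [m + 1] gives the diagram of [w s_m]. The label [N]  *)
(* may sit in a column other than the one that loses a box, but that column   *)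
(* is then contained in the shrinking one and an exchange of labels repairs   *)
(* it. By Hall's condition, the fillings of a column matter only through      *)
(* their sets of labels, which can be sorted from top to bottom.              *)

Require Import Defs.
From mathcomp Require Import all_boot all_order all_fingroup all_algebra.
From mathcomp Require Import zify ring mpoly.

Set Implicit Arguments.
Unset Strict Implicit.
Unset Printing Implicit Defensive.

Import Order.TTheory GRing.Theory Num.Theory.
Local Open Scope ring_scope.

(** Everything passes through [column_labels]: each column of the diagram receives a set of labels
    dominated by its set of rows. A perfect tableau yields such sets ([PerfectTab_column_labels]),
    and writing each set in increasing order down its column yields a column-strict tableau
    ([column_labels_PerfectTab_down]), so both kinds of tableaux exist for the same contents.

    It remains to match these contents with the exponents of the Schubert polynomial. By the
    Yang-Baxter equation, exchanging two adjacent variables in the Fomin-Stanley product multiplies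
    it by a single factor ([fomin_stanley_swap]). Read at a permutation with a descent, this is the
    divided difference recursion, whence [fomin_stanley_schubert]. Each factor of the product adds
    polynomials with nonnegative coefficients, so nothing cancels and supports can be followed one
    factor at a time. The labellings obey the same recursion ([labelled_step]), the delicate case
    being settled by [fits_exchange]. *)

(** * The Fomin-Stanley product in the nilCoxeter algebra *)

Section NilCoxeter.
Variables (n : nat) (R : comNzRingType).
Implicit Types (i j k m : nat) (x y : R) (w : 'S_n.+1) (f : {ffun 'S_n.+1 -> R}).

Definition simple_tperm m : 'S_n.+1 := tperm (inord m) (inord m.+1).

Definition descent w m : bool := (w (inord m.+1) < w (inord m))%N.

(** With [f] read as the sum of the [f w] times the basis element of [w], this is right
    multiplication by 1 + x u_m; the usual w s_m is written [simple_tperm m * w]. *)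
Definition hfactor m x f : {ffun 'S_n.+1 -> R} :=
  [ffun w => f w + if descent w m then x * f (simple_tperm m * w)%g else 0].

Lemma inord_neq i j : (i <= n)%N -> (j <= n)%N -> i != j ->
  (inord i : 'I_n.+1) != inord j.
Proof. by move=> li lj; rewrite -val_eqE /= !inordK. Qed.

Lemma hfactorD m x y f : (m < n)%N ->
  hfactor m x (hfactor m y f) = hfactor m (x + y) f.
Proof.
move=> lm; apply/ffunP => w; rewrite !ffunE /descent !permM tpermL tpermR.
rewrite mulgA tperm2 mul1g.
by case: ltngtP => _; ring.
Qed.

Lemma hfactor0 m f : hfactor m 0 f = f.
Proof. by apply/ffunP => w; rewrite !ffunE mul0r if_same addr0. Qed.

Lemma hfactorC i j x y f : (i.+1 < j)%N -> (j < n)%N ->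
  hfactor i x (hfactor j y f) = hfactor j y (hfactor i x f).
Proof.
move=> lij lj; apply/ffunP => w; rewrite !ffunE /descent !permM.
have d a b : (a <= n)%N -> (b <= n)%N -> a != b -> (inord a : 'I_n.+1) != inord b.
  exact: inord_neq.
rewrite !(tpermD, d) //; try lia.
have -> : (simple_tperm j * (simple_tperm i * w) = simple_tperm i * (simple_tperm j * w))%g.
  rewrite !mulgA; congr (_ * _)%g; rewrite conjgC tpermJ !tpermD ?d //; lia.
by do 2 case: ifP => _; ring.
Qed.

(* The Yang-Baxter equation *)
Lemma hfactor_braid m x y f : (m.+1 < n)%N ->
  hfactor m x (hfactor m.+1 (x + y) (hfactor m y f))
  = hfactor m.+1 y (hfactor m (x + y) (hfactor m.+1 x f)).
Proof.
move=> lm; apply/ffunP => w; rewrite !ffunE /descent !permM.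
set a : 'I_n.+1 := inord m; set b : 'I_n.+1 := inord m.+1; set c : 'I_n.+1 := inord m.+2.
have ab : a != b by apply: inord_neq; lia.
have bc : b != c by apply: inord_neq; lia.
have ac : a != c by apply: inord_neq; lia.
have [ba cb ca] : [/\ b != a, c != b & c != a] by rewrite ![_ == a]eq_sym [c == _]eq_sym.
rewrite !(tpermL, tpermR, tpermD ac bc, tpermD ba ca) //.
rewrite /simple_tperm -/a -/b -/c.
have braid : (tperm a b * tperm b c * tperm a b = tperm b c * tperm a b * tperm b c)%g.
  rewrite -!mulgA [(tperm b c * tperm a b)%g]conjgC.
  rewrite [(tperm a b * tperm b c)%g]conjgC !tpermJ !mulgA !tperm2 !mul1g.
  by rewrite tpermR tpermL (tpermD ac bc) (tpermD ba ca).
rewrite !mulgA braid !tperm2 !mul1g.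
by case: (ltngtP (w a) (w b)) => ?; case: (ltngtP (w b) (w c)) => ?;
  case: (ltnP (w c) (w a)) => ?; try lia; ring.
Qed.

(* The operators are numbered from the last letter, so that [hprod k] only    *)
(* involves the letters [n - k, ..., n - 1].                                  *)
Fixpoint hprod k x f :=
  if k is k'.+1 then hfactor (n - k) x (hprod k' x f) else f.

Lemma hfactor_hprodC i k x y f : (i.+1 < n - k)%N ->
  hfactor i x (hprod k y f) = hprod k y (hfactor i x f).
Proof.
elim: k f => [//|k IHk] f lik /=.
by rewrite hfactorC ?IHk //; lia.
Qed.

(** Splitting the outer factor x as y and x - y puts three factors in Yang-Baxter position; the
    leftover factors are then absorbed into products that are one letter shorter. *)
Lemma hprodC k x y f : (k <= n)%N ->
  hprod k x (hprod k y f) = hprod k y (hprod k x f).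
Proof.
(* The passage to k + 2 peels off two letters and uses commutation at k + 1, so two consecutive
   lengths are carried together. *)
suff H : (k <= n)%N -> (forall g, hprod k x (hprod k y g) = hprod k y (hprod k x g)) /\
    ((k < n)%N -> forall g, hprod k.+1 x (hprod k.+1 y g) = hprod k.+1 y (hprod k.+1 x g)).
  by move=> /H[].
elim: k => [|k IHk] lk.
  by split=> // l0 g; rewrite /= !hfactorD ?[x + y]addrC //; lia.
have [_ /(_ lk) IH] := IHk (ltnW lk); split=> // lk1 g.
have Em : (n - k.+1)%N = (n - k.+2).+1 by lia.
have lm : ((n - k.+2).+1 < n)%N by lia.
have lm0 := ltnW lm.
have absorb z z' h : hfactor (n - k.+2).+1 z (hprod k z' h)
    = hfactor (n - k.+2).+1 (z - z') (hprod k.+1 z' h).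
  by rewrite /= Em hfactorD ?subrK.
have far z z' h : hprod k z (hfactor (n - k.+2) z' h) = hfactor (n - k.+2) z' (hprod k z h).
  by rewrite hfactor_hprodC //; lia.
set A1 := hprod k.+1 in IH absorb *.
have A1E z h : A1 z h = hfactor (n - k.+2).+1 z (hprod k z h) by rewrite /A1 /= Em.
have A2E z h : hprod k.+2 z h = hfactor (n - k.+2) z (A1 z h) by [].
rewrite !A2E [A1 x _]A1E [A1 y (hfactor _ _ _)]A1E !far.
have split h : hfactor (n - k.+2) x h
    = hfactor (n - k.+2) y (hfactor (n - k.+2) (x - y) h).
  by rewrite hfactorD // addrC subrK.
rewrite split; have := hfactor_braid (x - y) y (hprod k x (A1 y g)) lm.
rewrite subrK => ->.
rewrite absorb addrAC subrr sub0r IH.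
rewrite -[- y in LHS]sub0r -absorb hfactor0 // -!far -!A1E.
Qed.

Definition one_delta : {ffun 'S_n.+1 -> R} := [ffun w => (w == 1%g)%:R].

Fixpoint fomin_stanley (X : nat -> R) N : {ffun 'S_n.+1 -> R} :=
  if N is N'.+1 then hprod (n - N') (X N') (fomin_stanley X N') else one_delta.

(** Completing the block of X_(m+1) by the letter m makes it commute with the block of X_m; the only
    asymmetry left is the compensating factor with parameter - X_(m+1). Later blocks involve letters
    beyond m + 1 only, and commute with the letter m. *)
Lemma fomin_stanley_swap (X Y : nat -> R) m N : (m < n)%N -> (m.+1 < N <= n.+1)%N ->
    Y m = X m.+1 -> Y m.+1 = X m -> (forall l, (l <= n)%N -> l != m -> l != m.+1 -> Y l = X l) ->
  fomin_stanley Y N = hfactor m (X m.+1 - X m) (fomin_stanley X N).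
Proof.
move=> lm lN Ym Ym1 Yl.
have lo l : (l <= m)%N -> fomin_stanley Y l = fomin_stanley X l.
  by elim: l => //= l IHl lm'; rewrite IHl ?Yl //; lia.
elim: N lN => // N IHN; rewrite !ltnS leq_eqVlt => /andP[/orP[/eqP <-|lN] lNn] /=.
  rewrite Ym Ym1 lo // (_ : n - m = (n - m.+1).+1)%N; last lia.
  have Em : (n - (n - m.+1).+1)%N = m by lia.
  have absorb z h : hprod (n - m.+1) z h = hfactor m (- z) (hprod (n - m.+1).+1 z h).
    by rewrite /= Em hfactorD // addNr hfactor0.
  rewrite absorb hprodC; last lia.
  by rewrite [in RHS]absorb hfactorD // addrAC subrr sub0r.
rewrite IHN ?Yl ?hfactor_hprodC //; lia.
Qed.

End NilCoxeter.

(** * Counting the elements of a set that satisfy a predicate *)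

Section Selection.
Variable n : nat.
Implicit Types (A : {set 'I_n}) (P : pred 'I_n).

Definition nsel A P := #|[set b in A | P b]|.

Lemma nsel_D1 A P a : a \in A ->
  nsel A P = (P a + nsel (A :\ a) P)%N.
Proof.
move=> aA; rewrite /nsel (cardsD1 a) !inE aA /=; congr (_ + #|pred_of_set _|)%N.
by apply/setP => b; rewrite !inE andbA.
Qed.

Lemma nsel_U1 A P a : a \notin A ->
  nsel (a |: A) P = (P a + nsel A P)%N.
Proof. by move=> aA; rewrite (nsel_D1 _ (setU11 a A)) setU1K. Qed.

Lemma nsel_sub A A' P P' : {in A, forall b, P b -> (b \in A') && P' b} ->
  (nsel A P <= nsel A' P')%N.
Proof.
move=> H; apply/subset_leq_card/subsetP => b; rewrite !inE => /andP[bA Pb].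
exact: H.
Qed.

Lemma nsel_preim (s : 'S_n) A P :
  nsel (s @^-1: A) P = nsel A (fun q => P (s^-1%g q)).
Proof.
rewrite /nsel -(card_imset _ (@perm_inj _ s)); apply: eq_card => q; rewrite !inE.
apply/imsetP/andP => [[p]|[qA Pq]].
  by rewrite !inE => /andP[pA Pp] ->; rewrite permK.
by exists (s^-1%g q); rewrite ?inE permKV ?qA.
Qed.

End Selection.

(* Elaborated finite types occur both with and without [reverse_coercion],    *)
(* which would make [lia] tell apart equal cardinals.                         *)
Ltac nlia := unfold reverse_coercion in *; lia.

(** * Hall's condition for one column along the flag *)

Section Fits.
Variables (n : nat) (N : 'I_n.+1).
Implicit Types (m t : nat) (B C : {set 'I_n.+1}) (w : 'S_n.+1) (c p : 'I_n.+1).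

(* Number of labels allowed in row [p] once [1 + x_N u_m] has been reached:   *)
(* rows below [N] are flagged by themselves, rows from [m] on may use the     *)
(* label [N], and the rows between may not.                                   *)
Definition flag (N m p : nat) := minn p.+1 (N + (m <= p)).

(* Hall's condition for filling the boxes of a column [C] with the set of     *)
(* labels [B] along the flag.                                                 *)
Definition fits (N m : nat) C B := #|B| = #|C| /\
  forall t, (nsel B (fun b => t <= b)%N <= nsel C (fun p => t < flag N m p)%N)%N.

Lemma fits_le m C B b : fits N m C B -> b \in B -> (b <= N)%N.
Proof.
move=> [_ /(_ b) H] bB; have : (0 < nsel C (fun p => b < flag N m p)%N)%N.
  by apply: leq_trans H; apply/card_gt0P; exists b; rewrite inE bB /=.
by case/card_gt0P => p; rewrite inE /flag => /andP[_]; lia.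
Qed.

Lemma fits_ge m C B t : fits N m C B -> (N < t)%N ->
  nsel B (fun b => t <= b)%N = 0%N.
Proof.
move=> Fb lt; apply: eq_card0 => b; rewrite !inE; apply/negbTE/negP => /andP[bB].
by have := fits_le Fb bB; lia.
Qed.

Lemma fits_top m C B : fits N m C B ->
  nsel B (fun b => N <= b)%N = (N \in B).
Proof.
move=> Fb; case NB: (N \in B).
  transitivity #|[set N]|; last exact: cards1.
  apply: eq_card => b; rewrite !inE.
  apply/andP/eqP => [[bB leN]|->]; last by [].
  by apply/val_inj/eqP; rewrite eqn_leq leN (fits_le Fb bB).
apply: eq_card0 => b; rewrite !inE; apply/negbTE/negP => /andP[bB leN].
by move: NB; rewrite (_ : N = b) ?bB //; apply/val_inj/eqP; rewrite eqn_leq leN (fits_le Fb bB).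
Qed.

(** The two flags differ only in row m, which loses the label N, so only the inequality at t = N can
    change. *)
Lemma fits_step m C B : (N <= m)%N ->
  fits N m.+1 C B <->
  fits N m C B /\ (N \in B -> exists2 p, p \in C & (m < p)%N).
Proof.
move=> lNm; split=> [Fb|[Fb HN]].
  split=> [|NB].
    split=> [|t]; first by case: Fb.
    case: Fb => _ /(_ t)/leq_trans; apply; apply: nsel_sub => p -> /=.
    by rewrite /flag; lia.
  have := Fb.2 N; rewrite (fits_top Fb) NB => /card_gt0P[p].
  by rewrite inE => /andP[pC]; rewrite /flag => lt; exists p => //; lia.
split=> [|t]; first by case: Fb.
have [->|neq] := eqVneq t N.
  rewrite (fits_top Fb); case: (boolP (N \in B)) => // /HN[p pC lp].
  by apply/card_gt0P; exists p; rewrite inE pC /flag; lia.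
apply: leq_trans (Fb.2 t) _; apply: nsel_sub => p -> /=.
by rewrite /flag; lia.
Qed.

(** After the swap, row m of [C] becomes row m + 1 and keeps access to the label N, while row m + 1
    loses it. *)
Lemma fits_swap m C B : (N <= m)%N -> (m < n)%N ->
  fits N m.+1 (simple_tperm n m @^-1: C) B <->
  fits N m C B /\ (N \in B -> exists2 p : 'I_n.+1, p \in C & (p == m :> nat) || (m.+1 < p)%N).
Proof.
move=> lNm lm; set s := simple_tperm n m.
have cards : #|s @^-1: C| = #|C|.
  by rewrite -[s]invgK preim_permV card_imset //; apply: perm_inj.
have sE p : (s^-1%g p : nat) = if p == m :> nat then m.+1 else if p == m.+1 :> nat then m else p.
  rewrite tpermV -[p in LHS]inord_val.
  case: tpermP => [/(congr1 val)|/(congr1 val)|/eqP n1 /eqP n2] /=; rewrite ?inordK //; try lia.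
  - by move=> ->; rewrite eqxx.
  - by move=> ->; rewrite eqxx; case: eqP => //; lia.
  by move: n1 n2; rewrite -!val_eqE /= !inordK //; try lia; move=> /negbTE -> /negbTE ->.
rewrite /fits cards; split=> [Fb|[Fb HN]].
  split=> [|NB].
    split=> [|t]; first by case: Fb.
    case: Fb => _ /(_ t)/leq_trans; apply; rewrite nsel_preim.
    by apply: nsel_sub => p -> /=; rewrite sE /flag;
      case: (nat_of_ord p =P m) => ? /=; case: (nat_of_ord p =P m.+1) => ? /=; lia.
  have := Fb.2 N; rewrite -cards in Fb; rewrite (fits_top Fb) NB nsel_preim => /card_gt0P[p].
  rewrite inE => /andP[pC]; rewrite sE /flag => lt; exists p => //; move: lt.
  by 
      case: (nat_of_ord p =P m) => ? /=; case: (nat_of_ord p =P m.+1) => ? /=; lia.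
split=> [|t]; first by case: Fb.
rewrite nsel_preim; have [->|neq] := eqVneq t N.
  rewrite (fits_top Fb); case: (boolP (N \in B)) => // /HN[p pC lp].
  apply/card_gt0P; exists p; rewrite inE pC sE /flag; move: lp.
  by 
      case: (nat_of_ord p =P m) => ? /=; case: (nat_of_ord p =P m.+1) => ? /=; lia.
apply: leq_trans (Fb.2 t) _; apply: nsel_sub => p -> /=.
by rewrite sE /flag;
      case: (nat_of_ord p =P m) => ? /=; case: (nat_of_ord p =P m.+1) => ? /=; lia.
Qed.

End Fits.

(** * The recursion on labellings given by one factor *)

Section Step.
Variable n : nat.
Implicit Types (m t : nat) (N c p : 'I_n.+1) (B C : {set 'I_n.+1}) (w : 'S_n.+1).
Implicit Type alpha : 'X_{1..n.+1}.

Definition column k (D : {set 'I_k * 'I_k}) (c : 'I_k) : {set 'I_k} :=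
  [set p | (p, c) \in D].

Local Notation col w c := (column (rothe w) c).

Lemma in_col w c p : (p \in col w c) = (c < w p)%N && (p < (w^-1)%g c)%N.
Proof. by rewrite !inE. Qed.

Lemma simple_tpermE m p : (m < n)%N ->
  (simple_tperm n m p : nat) = if p == m :> nat then m.+1 else if p == m.+1 :> nat then m else p.
Proof.
move=> lm; case: tpermP => [->|->|/eqP n1 /eqP n2] /=.
- by rewrite !inordK ?eqxx //; lia.
- by rewrite !inordK ?eqxx //; try lia; case: eqP => //; lia.
move: n1 n2; rewrite -!val_eqE /= !inordK //; try lia.
by move=> /negbTE -> /negbTE ->.
Qed.

(** Undoing the descent removes the box in row m and column w(m + 1), then exchanges rows m and m +
    1. *)
Lemma column_descent w m c : (m < n)%N -> descent w m ->
  col (simple_tperm n m * w)%g c = simple_tperm n m @^-1: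
    (if c == w (inord m.+1) then col w c :\ inord m else col w c).
Proof.
move=> lm dw; set s := simple_tperm n m; apply/setP => p.
have E (r : 'I_n.+1) k : (k <= n)%N -> (r == inord k) = (r == k :> nat).
  by move=> lk; rewrite -val_eqE /= inordK.
have [q ->] : exists q, c = w q by exists (w^-1%g c); rewrite permKV.
rewrite (inj_eq perm_inj) E // in_col permM invMg permM tpermV -/(simple_tperm n m) -/s permK inE.
have -> : (s p \in if q == m.+1 :> nat then col w (w q) :\ inord m else col w (w q))
    = (w q < w (s p))%N && (s p < q)%N && ~~ ((q == m.+1 :> nat) && (s p == m :> nat)).
  case: (nat_of_ord q =P m.+1) => _; last by rewrite in_col permK andbT.
  by rewrite in_setD1 in_col permK E ?(ltnW lm) // andbC.
have : (w q < w (s p))%N -> q = m :> nat -> p != m :> nat.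
  move=> lt Eq; apply/eqP => Ep; have Epq : p = q by apply: val_inj; rewrite /= Ep.
  move: lt dw; rewrite /descent /s /simple_tperm -Ep inord_val tpermL Epq; lia.
case: (w q < w (s p))%N => //= /(_ isT); rewrite !simple_tpermE //.
case: (nat_of_ord p =P m) => ? /=; case: (nat_of_ord p =P m.+1) => ? /=;
case: (nat_of_ord q =P m) => ? /=; case: (nat_of_ord q =P m.+1) => ? /=; lia.
Qed.

Lemma fits_witness N m C B : fits N m C B -> N \in B -> exists2 p, p \in C & (m <= p)%N.
Proof.
move=> Fb NB; have := Fb.2 N; rewrite (fits_top Fb) NB => /card_gt0P[p].
by rewrite inE /flag => /andP[pC lt]; exists p => //; nlia.
Qed.

Lemma flag_at N m (a : 'I_n.+1) : a = m :> nat -> (N <= m)%N -> flag N m a = N.+1.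
Proof. by move=> ->; rewrite /flag; nlia. Qed.

Lemma fits_addN N m C B (a : 'I_n.+1) : a = m :> nat -> (N <= m)%N -> a \in C ->
  N \notin B -> fits N m (C :\ a) B -> fits N m C (N |: B).
Proof.
move=> Ea lNm aC NB [E F]; split; first by rewrite cardsU1 NB (cardsD1 a C) aC E.
move=> t; rewrite (nsel_U1 _ NB) (nsel_D1 _ aC); have := F t.
rewrite /= (flag_at Ea lNm) ltnS; nlia.
Qed.

Lemma fits_delN N m C B (a : 'I_n.+1) : a = m :> nat -> (N <= m)%N -> a \in C ->
  N \in B -> fits N m C B -> fits N m (C :\ a) (B :\ N).
Proof.
move=> Ea lNm aC NB Fb; split.
  by have := Fb.1; rewrite (cardsD1 a C) aC (cardsD1 N B) NB => -[].
move=> t; have := Fb.2 t; rewrite (nsel_D1 _ NB) (nsel_D1 _ aC) (flag_at Ea lNm) ltnS.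
have [le|lt] := leqP t N; first by nlia.
have := fits_ge Fb lt; rewrite (nsel_D1 _ NB); nlia.
Qed.

(* The label to exchange is the largest one missing from [B].                 *)
Lemma fits_exchange N m C C0 B B0 (a : 'I_n.+1) : a = m :> nat -> (N <= m)%N ->
    a \in C0 -> C \subset C0 -> N \in B -> N \notin B0 ->
    fits N m C B -> fits N m C0 B0 ->
  exists x, [/\ x \in B0, x \notin B, fits N m C (x |: B :\ N) & fits N m (C0 :\ a) (B0 :\ x)].
Proof.
move=> Ea lNm aC0 sC NB NB0 Fb F0.
have [x0 x0B0 x0B] : exists2 x, x \in B0 & x \notin B.
  apply/subsetPn/negP => sB; suff /eqP E : B0 == B by rewrite E NB in NB0.
  by rewrite eqEcard sB Fb.1 F0.1 subset_leq_card.
have P0 : (x0 \in B0) && (x0 \notin B) by rewrite x0B0.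
pose x := [arg max_(x > x0 | (x \in B0) && (x \notin B)) (x : nat)].
have [/andP[xB0 xB] xmax] : ((x \in B0) && (x \notin B)) /\
    forall y, y \in B0 -> y \notin B -> (y <= x)%N.
  rewrite /x; case: arg_maxnP => // y Py ymax; split=> // z zB0 zB.
  by apply: ymax; rewrite zB0.
have xN : (x < N)%N.
  rewrite ltn_neqAle (fits_le F0 xB0) andbT; apply: contraNneq NB0 => /val_inj <-.
  exact: xB0.
have xBN : x \notin B :\ N by rewrite !inE (negbTE xB) andbF.
exists x; split=> //; split.
- by rewrite cardsU1 xBN -Fb.1 (cardsD1 N B) NB.
- move=> t; rewrite (nsel_U1 _ xBN); have := Fb.2 t; rewrite (nsel_D1 _ NB).
  by nlia.
- by have := F0.1; rewrite (cardsD1 a C0) aC0 (cardsD1 x B0) xB0 => -[].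
move=> t; have := F0.2 t; rewrite (nsel_D1 _ xB0) (nsel_D1 _ aC0) (flag_at Ea lNm) ltnS.
have [letx|ltxt] := leqP t x; first by nlia.
have [letN|ltNt] := leqP t N; last first.
  by have := fits_ge F0 ltNt; rewrite (nsel_D1 _ xB0); nlia.
(* For x < t <= N, maximality of x puts all labels of [B0] from t on in [B], and they differ from N.
   Trading N therefore gains the unit needed to delete row m from [C0]. *)
have : (nsel (B0 :\ x) (fun b => t <= b) <= nsel (B :\ N) (fun b => t <= b))%N.
  apply: nsel_sub => b; rewrite !inE => /andP[_ bB0] ltb.
  rewrite ltb andbT; case: eqP => [Eb|_] /=; first by rewrite -Eb bB0 in NB0.
  by apply: contraLR ltxt => /(xmax _ bB0); nlia.
have := Fb.2 t; rewrite (nsel_D1 _ NB).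
have : (nsel C (fun p => t < flag N m p) <= nsel C0 (fun p => t < flag N m p))%N.
  by apply: nsel_sub => p pC ->; rewrite (subsetP sC).
by rewrite (nsel_D1 _ aC0) (flag_at Ea lNm) ltnS; nlia.
Qed.

(* A filling along the flag, each column [c] being given by its set [B c] of  *)
(* labels.                                                                    *)
Definition labelled (N m : nat) w alpha := exists2 B : 'I_n.+1 -> {set 'I_n.+1},
  forall c, fits N m (col w c) (B c) & forall k, alpha k = (\sum_c (k \in B c))%N.

(** This is the support of [hfactor]: either the factor contributes 1, or it contributes x_N u_m,
    which accounts for one label N and one box of column w(m + 1). *)
Lemma labelled_step N m w alpha : (N <= m)%N -> (m < n)%N ->
  labelled N m w alpha <-> labelled N m.+1 w alpha \/ descent w m /\
    exists2 beta, labelled N m.+1 (simple_tperm n m * w)%g beta & alpha = (beta + U_(N))%MM.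
Proof.
move=> lNm lm; set s := simple_tperm n m.
pose a : 'I_n.+1 := inord m; pose b : 'I_n.+1 := inord m.+1; pose c0 := w b.
have Ea : a = m :> nat by rewrite inordK //; nlia.
have Eb : b = m.+1 :> nat by rewrite inordK //; nlia.
have c0K : (w^-1)%g c0 = b by rewrite permK.
have ac0 : descent w m -> a \in col w c0.
  by rewrite in_col c0K Ea Eb ltnSn andbT.
split; last first.
  case=> [[B FB EB]|[dw [beta [B FB EB] ->]]].
    by exists B => // c; have /(fits_step _ _ lNm)[] := FB c.
  have {}FB c : fits N m (if c == c0 then col w c :\ a else col w c) (B c) /\
      (N \in B c -> c != c0).
    have := FB c; rewrite column_descent // => /fits_swap-/(_ lNm lm)[Fb H]; split=> //.
    move=> /H; case: eqP => // -> [p]; rewrite in_setD1 in_col c0K -val_eqE /= Ea Eb.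
    by move=> /and3P[] *; nlia.
  exists (fun c => if c == c0 then N |: B c else B c) => [c|k].
    have [] := FB c; case: eqP => [-> Fc NB|//].
    by apply: (fits_addN Ea) (Fc) => //; [exact: ac0 | apply/negP => /NB].
  rewrite mnmDE EB mnm1E (bigD1 c0) //= [RHS](bigD1 c0) //= eqxx addnAC; congr (_ + _)%N.
    rewrite in_setU1 [N == k]eq_sym; case: eqP => [->|_]; last by rewrite addn0.
    by case: (boolP (N \in B c0)) => // /(FB c0).2; rewrite eqxx.
  by apply: eq_bigr => c /negbTE ->.
case=> B FB EB.
have build (B' : 'I_n.+1 -> {set 'I_n.+1}) : descent w m ->
    (forall c, fits N m (if c == c0 then col w c :\ a else col w c) (B' c)) ->
    N \notin B' c0 -> (forall k, alpha k = \sum_c (k \in B' c) + (k == N))%N ->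
  exists2 beta, labelled N m.+1 (s * w)%g beta & alpha = (beta + U_(N))%MM.
  move=> dw FB' NB' EB'; exists [multinom (\sum_c (k \in B' c))%N | k < n.+1]; last first.
    by apply/mnmP => k; rewrite mnmDE mnmE mnm1E EB' [N == k]eq_sym.
  exists B' => [c|k]; last by rewrite mnmE.
  rewrite column_descent //; apply/fits_swap => //; split; first exact: FB'.
  (* The label N has a row from m on; if that row is m + 1, the descent puts row m in the same
     column. *)
  move=> NBc; have := fits_witness (FB' c) NBc.
  have [Ec|nc] := eqVneq c c0; first by rewrite Ec (negbTE NB') in NBc.
  case=> p pC lp; have [Ep|np] := eqVneq (p : nat) m.+1; last first.
    by exists p => //; nlia.
  exists a; rewrite ?Ea ?eqxx //; move: pC; rewrite !in_col.
  have -> : p = b by apply: val_inj; rewrite /= Ep.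
  by move: dw; rewrite /descent -/a -/b; nlia.
(* A bad column is the only obstruction to advancing the flag with the same labels. It contains row
   m but not row m + 1, which forces a descent at m. *)
pose bad c := (N \in B c) && [forall p in col w c, (p <= m)%N].
case: (pickP bad) => [c /andP[NBc /forall_inP colm]|good]; last first.
  left; exists B => // c; apply/fits_step => //; split=> // NBc.
  have := good c; rewrite /bad NBc /= => /negbT; rewrite negb_forall_in.
  by case/exists_inP => p pC; rewrite -ltnNge; exists p.
have ac : a \in col w c.
  have [p pC lp] := fits_witness (FB c) NBc; suff <- : p = a by [].
  by apply: val_inj; apply/eqP; rewrite /= eqn_leq Ea colm.
have nbc : b \notin col w c by apply/negP => /colm; rewrite Eb ltnn.
have dw : descent w m.
  rewrite /descent -/a -/b ltnNge; apply: contraNN nbc => le.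
  move: ac; rewrite !in_col => /andP[lt1 lt2]; rewrite (leq_trans lt1 le) /=.
  rewrite ltn_neqAle Eb -[in X in _ && X]Ea lt2 andbT -Eb; apply: contraTneq lt1.
  by move/val_inj/(congr1 w); rewrite permKV => <-; rewrite -leqNgt.
right; split=> //; have [NB0|NB0] := boolP (N \in B c0).
  apply: (build (fun c => if c == c0 then B c :\ N else B c)) => //.
  - move=> c'; case: eqP => [->|//]; apply: fits_delN => //; exact: ac0.
  - by rewrite eqxx !inE eqxx.
  move=> k; rewrite EB (bigD1 c0) //= [in RHS](bigD1 c0) //= eqxx addnAC; congr (_ + _)%N.
    by rewrite in_setD1; case: eqP => [->|_]; rewrite ?NB0 ?addn0.
  by apply: eq_bigr => c' /negbTE ->.
have cc0 : c != c0 by apply: contraNneq NB0 => <-.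
(* The label N is missing from the column that loses a box, so it must be traded with the bad
   column; the inequality c0 < c gives the inclusion of columns that the exchange requires. *)
have lc : (c0 < c)%N.
  rewrite ltnNge leq_eqVlt negb_or [_ == _](negbTE cc0) /=.
  apply: contraNN nbc => lt; move: ac; rewrite !in_col => /andP[lt1 lt2].
  rewrite lt /= ltn_neqAle Eb -[in X in _ && X]Ea lt2 andbT -Eb.
  by apply: contraNneq cc0 => /val_inj/(congr1 w); rewrite permKV => <-.
have sC : col w c \subset col w c0.
  apply/subsetP => p pC; have := colm _ pC; move: pC.
  by rewrite !in_col c0K Eb ltnS => /andP[lt _] ->; rewrite (ltn_trans lc lt).
have [x [xB0 xB Fc F0]] := fits_exchange Ea lNm (ac0 dw) sC NBc NB0 (FB c) (FB c0).
apply: (build (fun c' => if c' == c0 then B c0 :\ x else if c' == c then x |: B c :\ N else B c')) => //.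
- by move=> c'; case: eqP => [->|_] //; case: eqP => [->|_].
- by rewrite eqxx in_setD1 (negbTE NB0) andbF.
move=> k; rewrite EB (bigD1 c0) //= (bigD1 c) //= [in RHS](bigD1 c0) //= [in RHS](bigD1 c) //=.
rewrite !eqxx (negbTE cc0) !inE.
have -> : (\sum_(i < n.+1 | (i != c0) && (i != c))
    (k \in (if i == c0 then B c0 :\ x else if i == c then x |: B c :\ N else B i))
  = \sum_(i < n.+1 | (i != c0) && (i != c)) (k \in B i))%N.
  by apply: eq_bigr => i /andP[/negbTE -> /negbTE ->].
have xN : x == N = false by apply/eqP => E; rewrite E (negbTE NB0) in xB0.
move: (\sum_(i < n.+1 | _) _)%N => r.
have [->|nkx] := eqVneq k x; first by rewrite xB0 (negbTE xB) xN /= !addn0.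
have [->|nkN] := eqVneq k N; first by rewrite NBc (negbTE NB0) /= !add0n addnC.
by rewrite /= addn0.
Qed.

End Step.

(** * Polynomials with nonnegative coefficients and prescribed support *)

Section Positivity.
Variable n : nat.
Implicit Types (p q : {mpoly int[n]}) (a b : 'X_{1..n}) (P Q : 'X_{1..n} -> Prop).

Definition positive_on P p :=
  forall a, 0 <= p@_a /\ (0 < p@_a <-> P a).

Lemma positive_onMX P p (i : 'I_n) : positive_on P p ->
  positive_on (fun a => exists2 b, P b & a = (b + U_(i))%MM) ('X_i * p).
Proof.
move=> Pp a; rewrite mulrC; have [le_a|nle_a] := boolP (U_(i) <= a)%MM.
  rewrite -(submK le_a) addmC mcoeffMX; have [ge0 gt0] := Pp (a - U_(i))%MM.
  split=> //; rewrite gt0; split=> [Pa|[b Pb]]; first by exists (a - U_(i))%MM; rewrite // addmC.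
  by rewrite addmC => /addIm ->.
have -> : (p * 'X_i)@_a = 0.
  apply/eqP; rewrite mcoeff_eq0 (perm_mem (msuppMX _ _)); apply: contra nle_a.
  by case/mapP => b _ ->; apply: lem_addr.
split=> //; split=> [|[b _ E]]; first by rewrite ltxx.
by rewrite E lem_addl in nle_a.
Qed.

Lemma positive_onD P Q p q : positive_on P p -> positive_on Q q ->
  positive_on (fun a => P a \/ Q a) (p + q).
Proof.
move=> Pp Qq a; have [p0 pP] := Pp a; have [q0 qQ] := Qq a; rewrite mcoeffD.
split; first exact: addr_ge0.
rewrite -pP -qQ; split=> [|[gt|gt]]; [|exact: ltr_wpDr|exact: ltr_wpDl].
by move: p0; rewrite le_eqVlt => /orP[/eqP <-|]; rewrite ?add0r; [right|left].
Qed.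

Lemma positive_on_ext P Q p : (forall a, P a <-> Q a) -> positive_on P p -> positive_on Q p.
Proof. by move=> PQ Pp a; rewrite -PQ. Qed.

Lemma positive_on0 : positive_on (fun=> False) 0.
Proof. by move=> a; rewrite mcoeff0 ltxx. Qed.

End Positivity.

(** * Supports of the partial Fomin-Stanley products *)

Section Support.
Variable n : nat.
Implicit Types (N c p : 'I_n.+1) (B C : {set 'I_n.+1}) (w : 'S_n.+1).
Implicit Type (alpha : 'X_{1..n.+1}).

Local Notation col w c := (column (rothe w) c).
Local Notation X := (fun k : nat => 'X_(inord k : 'I_n.+1) : {mpoly int[n.+1]}).

Lemma hfactor_positive N m (f : {ffun 'S_n.+1 -> {mpoly int[n.+1]}}) :
  (N <= m)%N -> (m < n)%N ->
  (forall w, positive_on (labelled N m.+1 w) (f w)) ->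
  forall w, positive_on (labelled N m w) (hfactor m 'X_N f w).
Proof.
move=> lNm lm Pf w; rewrite ffunE.
apply: (@positive_on_ext _ (fun alpha => labelled N m.+1 w alpha \/ descent w m /\
    exists2 beta, labelled N m.+1 (simple_tperm n m * w)%g beta & alpha = (beta + U_(N))%MM)).
  by move=> alpha; rewrite -labelled_step.
case: (boolP (descent w m)) => dw.
  apply: positive_on_ext _ (positive_onD (Pf w) (positive_onMX N (Pf (simple_tperm n m * w)%g))) => alpha.
  by split=> -[?|H]; [left|right; split|left|right; case: H].
apply: positive_on_ext _ (positive_onD (Pf w) (@positive_on0 n.+1)) => alpha.
by split=> -[?|//]; [left|left|case].
Qed.

Lemma column_max w c p : p \in col w c -> (p < n)%N.
Proof. by rewrite in_col => /andP[_ /leq_trans]; apply; rewrite -ltnS. Qed.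

Lemma fits_flag (N M : nat) m k C B : {in C, forall p, flag N m p = flag M k p} ->
  fits N m C B <-> fits M k C B.
Proof.
move=> E; suff H t : nsel C (fun p => t < flag N m p)%N = nsel C (fun p => t < flag M k p)%N.
  by rewrite /fits; split=> -[? F]; split=> // t; [rewrite -H|rewrite H].
by apply: eq_card => p; rewrite !inE; case: (boolP (p \in C)) => //= /E ->.
Qed.

(** The last row of a Rothe diagram is empty, and on the other rows the flag ending block N is the
    flag opening block N + 1. *)
Lemma labelled_next (N : nat) w alpha : (N < n)%N ->
  labelled N N w alpha <-> labelled N.+1 n w alpha.
Proof.
move=> lN; have FE c B : fits N N (col w c) B <-> fits N.+1 n (col w c) B.
  by apply: fits_flag => p /column_max; rewrite /flag; lia.
by split=> -[B FB EB]; exists B => // c; apply/FE.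
Qed.

Lemma rothe_eq0 w : rothe w = set0 -> w = 1%g.
Proof.
move=> D0; have [/(canRL (mulKg _))|ne] := eqVneq (w0 * w)%g w0; first by rewrite mulVg.
have [[i j] /andP[/= /eqP Ej lt]] := ex_ascent ne.
have : (rev_ord j, w (rev_ord i)) \in rothe w.
  move: lt; rewrite !permM !permE inE /= permK => -> /=.
  by have := ltn_ord j; lia.
by rewrite D0 inE.
Qed.

Lemma labelled_start w alpha : labelled 0 n w alpha <-> w = 1%g /\ alpha = 0%MM.
Proof.
split=> [[B FB EB]|[-> ->]].
  have empty c : B c = set0 /\ col w c = set0.
    have [E /(_ 0%N)] := FB c; rewrite [X in (_ <= X)%N](_ : _ = 0%N) ?leqn0.
      rewrite (_ : nsel _ _ = #|B c|); last by apply: eq_card => b; rewrite inE andbT.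
      by move=> B0; split; apply/eqP; rewrite -cards_eq0 -?E.
    apply: eq_card0 => p; rewrite inE; case: (boolP (p \in _)) => //= /column_max.
    by move=> lt; rewrite /flag (leqNgt n) lt minn0.
  split; last by apply/mnmP => k; rewrite EB mnm0E big1 // => c _; rewrite (empty c).1 inE.
  apply: rothe_eq0; apply/setP => -[p c]; rewrite inE.
  by have /setP/(_ p) := (empty c).2; rewrite !inE.
exists (fun=> set0) => [c|k]; last by rewrite mnm0E big1 // => c _; rewrite inE.
have -> : col 1%g c = set0.
  by apply/setP => p; rewrite in_col invg1 !perm1 inE; lia.
split=> // t; rewrite (_ : nsel _ _ = 0%N) //; apply: eq_card0 => b; rewrite inE in_set0 //.
Qed.

Lemma fomin_stanley_positive (N : nat) : (N <= n)%N ->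
  forall w, positive_on (labelled N n w) (fomin_stanley n X N w).
Proof.
elim: N => [_ w|N IHN lN w].
  apply: (@positive_on_ext _ (fun alpha => w = 1%g /\ alpha = 0%MM)) => [alpha|alpha].
    exact: iff_sym (labelled_start _ _).
  rewrite ffunE; case: eqP => [->|nw]; last by rewrite mcoeff0 ltxx; split=> //; split=> // -[].
  rewrite mcoeff1; case: eqP => [->|na]; first by split.
  by rewrite ltxx; split=> //; split=> // -[].
have sub k : (k <= n - N)%N -> forall v,
    positive_on (labelled N (n - k) v) (hprod k (X N) (fomin_stanley n X N) v).
  elim: k => [|k IHk] lk v; first by rewrite subn0; apply: IHN; lia.
  have := @hfactor_positive (inord N) (n - k.+1) (hprod k (X N) (fomin_stanley n X N)).
  rewrite inordK; last lia.
  apply; [lia|lia|]; rewrite (_ : (n - k.+1).+1 = (n - k)%N); last lia.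
  by apply: IHk; lia.
apply: positive_on_ext _ (sub _ (leqnn _) w) => alpha.
by rewrite subKn 1?ltnW // labelled_next.
Qed.

End Support.

(** * Dominated label sets and the case of the longest permutation *)

Section Dominance.
Variable n : nat.
Implicit Types (B C : {set 'I_n}) (D : {set 'I_n * 'I_n}) (alpha : 'X_{1..n}).

Definition dominated C B := #|B| = #|C| /\
  forall t, (nsel B (fun b => t <= b) <= nsel C (fun p => t <= p))%N.

Lemma nsel_compl B t :
  (#|B| = nsel B (fun b => t <= b) + nsel B (fun b => b < t))%N.
Proof.
rewrite -(cardsID [set b : 'I_n | (t <= b)%N] B) /nsel; congr (_ + _)%N;
  apply: eq_card => b; rewrite !inE ?ltnNge //; exact: andbC.
Qed.

Lemma dominated_closed C B :
  (forall p q : 'I_n, (q <= p)%N -> p \in C -> q \in C) -> dominated C B -> B = C.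
Proof.
move=> Cdown [E F]; apply/esym/eqP; rewrite eqEcard E leqnn andbT.
apply/subsetP => p pC; pose L := [set q : 'I_n | (q < p.+1)%N].
have EC : nsel C (fun q => q < p.+1)%N = #|L|.
  apply: eq_card => q; rewrite !inE andbC; case: (ltnP q p.+1) => //= le.
  exact: Cdown pC.
have le : (#|L| <= nsel B (fun b => b < p.+1)%N)%N.
  move: E (F p.+1); rewrite -EC (nsel_compl B p.+1) (nsel_compl C p.+1); nlia.
have : [set b in B | (b < p.+1)%N] == L.
  by rewrite eqEcard le andbT; apply/subsetP => b; rewrite !inE => /andP[].
by move=> /eqP/setP/(_ p); rewrite !inE ltnSn andbT.
Qed.

Definition column_labels D alpha := exists2 B : 'I_n -> {set 'I_n},
  forall c, dominated (column D c) (B c) & forall k, alpha k = (\sum_c (k \in B c))%N.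

Lemma column_w0 c (p : 'I_n) : (p \in column (rothe w0) c) = (c < n - p.+1)%N.
Proof.
have rK : (@w0 n)^-1%g = w0.
  by apply/eqP; rewrite eq_invg_mul; apply/eqP/permP => i; rewrite permM !permE rev_ordK.
by rewrite !inE rK !permE /=; have := ltn_ord p; have := ltn_ord c; lia.
Qed.

(** The columns of this staircase are initial segments, so each dominates only itself. *)
Lemma column_labels_w0 alpha :
  column_labels (rothe w0) alpha <-> alpha = [multinom (n - i.+1)%N | i < n].
Proof.
have cnt (k : 'I_n) : (\sum_(c < n) (k \in column (rothe w0) c) = n - k.+1)%N.
  transitivity (\sum_(c < n - k.+1) 1)%N; last by rewrite sum_nat_const card_ord muln1.
  rewrite (big_ord_widen n (fun=> 1%N)) ?leq_subr // [RHS]big_mkcond.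
  by apply: eq_bigr => c _; rewrite column_w0; case: ifP.
split=> [[B FB EB]|->].
  apply/mnmP => k; rewrite EB mnmE -cnt; apply: eq_bigr => c _.
  suff -> : B c = column (rothe w0) c by [].
  apply: dominated_closed (FB c) => p q le.
  by rewrite !column_w0; lia.
by exists (column (rothe w0)) => [c|k]; rewrite ?mnmE ?cnt.
Qed.

End Dominance.

(** * Ring morphisms applied to the Fomin-Stanley product *)

Section RMorphism.
Variables (n : nat) (R S : comNzRingType) (phi : {rmorphism R -> S}).

Lemma rmorph_hprod k x (f : {ffun 'S_n.+1 -> R}) :
  [ffun w => phi (hprod k x f w)] = hprod k (phi x) [ffun w => phi (f w)].
Proof.
elim: k => [//|k IHk] /=; rewrite -IHk; apply/ffunP => w; rewrite !ffunE rmorphD; congr (_ + _).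
by case: ifP => _; rewrite ?rmorphM ?rmorph0.
Qed.

Lemma rmorph_fomin_stanley (X : nat -> R) N :
  [ffun w => phi (fomin_stanley n X N w)] = fomin_stanley n (phi \o X) N.
Proof.
elim: N => [|N IHN] /=; last by rewrite -IHN rmorph_hprod.
by apply/ffunP => w; rewrite !ffunE rmorph_nat.
Qed.

End RMorphism.

(** * Comparison with Schubert polynomials *)

Section Schubert.
Variable n : nat.
Implicit Types (w : 'S_n.+1) (alpha : 'X_{1..n.+1}).

Local Notation X := (fun k : nat => 'X_(inord k : 'I_n.+1) : {mpoly int[n.+1]}).
Local Notation FS := (fomin_stanley n X n).

Lemma msym_fomin_stanley m w : (m < n)%N ->
  msym (simple_tperm n m) (FS w) = hfactor m (X m.+1 - X m) FS w.
Proof.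
(* The block of the last variable has no letters; adding it allows the swap at m = n - 1. *)
move=> lm; have FSn Y : fomin_stanley n Y n.+1 = fomin_stanley n Y n by rewrite /= subnn.
have XE k : msym (simple_tperm n m) (X k) = 'X_(simple_tperm n m (inord k)).
  by rewrite /msym mmapX mmap1U.
have := @rmorph_fomin_stanley n _ _ (msym (simple_tperm n m)) X n.
move/ffunP/(_ w); rewrite ffunE => ->.
rewrite -!FSn (@fomin_stanley_swap _ _ X _ m) //=.
- by rewrite !ltnS lm leqnn.
- by rewrite XE tpermL.
- by rewrite XE tpermR.
move=> l ln nlm nlm1; rewrite XE tpermD //; apply: inord_neq; rewrite // 1?eq_sym //.
exact: ltnW.
Qed.

Lemma fomin_stanley_column_labels w : positive_on (column_labels (rothe w)) (FS w).
Proof.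
apply: positive_on_ext _ (fomin_stanley_positive (leqnn n) w) => alpha.
split=> -[B FB EB]; exists B => // c; have [E F] := FB c; split=> // t;
  rewrite (leq_trans (F t)) //; apply: nsel_sub => p pC;
  by rewrite pC /flag; have := column_max pC; lia.
Qed.

(** Both families satisfy the same descending recursion from [w0], where both are supported on the
    staircase monomial; c is the coefficient found there. *)
Lemma fomin_stanley_schubert : exists2 c : int, 0 < c &
  forall w, FS w = c *: schubert w.
Proof.
pose delta : 'X_{1..n.+1} := [multinom (n.+1 - i.+1)%N | i < n.+1].
have pos := fomin_stanley_column_labels w0.
pose c := (FS w0)@_delta; have c_gt0 : 0 < c.
  by apply/(pos delta).2; apply/column_labels_w0.
exists c => // w; have [k lek] := ubnP (colength w); elim: k w lek => // k IHk w.
rewrite ltnS => lek; have [->|/ex_ascent[p asc]] := eqVneq w w0.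
  rewrite schubert_w0; apply/mpolyP => alpha; rewrite mcoeffZ mcoeffX.
  case: eqP => [<-|ne]; first by rewrite mulr1.
  rewrite mulr0; apply/eqP; rewrite eq_le (pos alpha).1 andbT leNgt.
  by apply/negP => /(pos alpha).2/column_labels_w0/esym.
have lt_v := colength_ascent asc; case: p asc lt_v => i j /= asc lt_v.
have [/= /eqP Ej lt] := andP asc; set v := (tperm i j * w)%g in lt_v.
have lin : (i < n)%N by have := ltn_ord j; rewrite Ej ltnS.
have Es : tperm i j = simple_tperm n i.
  by rewrite /simple_tperm -Ej !inord_val.
rewrite (schubert_ascent Ej lt) -/v; set g := divdiff _ _ _.
have neq : i != j by rewrite -val_eqE /= Ej; lia.
apply: (mulIf (divdiff_neq0 neq)); rewrite -scalerAl divdiffE.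
have Ev := IHk v (leq_trans lt_v lek).
rewrite scalerBr -msymZ -Ev Es msym_fomin_stanley // ffunE /descent -Ej !inord_val.
rewrite /v !permM tpermL tpermR lt -Es mulgA tperm2 mul1g.
by rewrite opprD addrA subrr sub0r -mulNr opprB mulrC.
Qed.

Lemma schubert_gt0 w alpha :
  0 < (schubert w)@_alpha <-> column_labels (rothe w) alpha.
Proof.
have [c c_gt0 E] := fomin_stanley_schubert.
by rewrite -(fomin_stanley_column_labels w alpha).2 E mcoeffZ pmulr_rgt0.
Qed.

End Schubert.

(** * Ranks of elements in a set of ordinals *)

Section Rank.
Variable n : nat.
Implicit Types (A : {set 'I_n}) (P : pred 'I_n) (x y : 'I_n).

Lemma nsel_count A P : nsel A P = count P (enum A).
Proof.
rewrite -sum1_count big_enum_cond /nsel -sum1_card.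
by apply: eq_bigl => b; rewrite inE.
Qed.

Lemma sorted_enum_ord A : sorted (fun x y => x < y)%N (enum A).
Proof.
rewrite {1}/enum_mem -enumT; apply: sorted_filter => [y x z|]; first exact: ltn_trans.
by rewrite -(@sorted_map _ _ val ltn) val_enum_ord iota_ltn_sorted.
Qed.

Lemma nsel_index A x : x \in A -> nsel A (fun b => b < x)%N = index x (enum A).
Proof.
rewrite nsel_count -mem_enum; elim: (enum A) (sorted_enum_ord A) => //= y s IHs ps.
have lts z : z \in s -> (y < z)%N.
  by apply/allP: z; apply: order_path_min ps => a b c; apply: ltn_trans.
rewrite in_cons eq_sym; case: eqP => [E _|_ /= xs].
  subst x.
  rewrite ltnn (@eq_in_count _ _ pred0) ?count_pred0 // => z /lts.
  by move/ltnW; rewrite leqNgt => /negbTE ->.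
by rewrite lts // IHs // (path_sorted ps).
Qed.

Lemma nsel_lt A x (y : nat) : x \in A -> (x < y)%N ->
  (nsel A (fun b => b < x) < nsel A (fun b => b < y))%N.
Proof.
move=> xA lt; rewrite [X in (_ < X)%N](nsel_D1 _ xA) lt ltnS.
by apply: nsel_sub => b bA ltb; rewrite !inE bA (ltn_trans ltb lt) andbT -val_eqE neq_ltn ltb.
Qed.

Lemma nsel_ltn_index A i : (i < #|A|)%N ->
  exists2 x, x \in A & nsel A (fun b => b < x)%N = i.
Proof.
move=> lti; have ne : enum A != [::] by rewrite -size_eq0 -cardE -lt0n; apply: leq_ltn_trans lti.
case E: (enum A) ne => [//|x0 s] _; clear s E.
have xA : nth x0 (enum A) i \in A by rewrite -mem_enum mem_nth -?cardE.
exists (nth x0 (enum A) i) => //.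
by rewrite (nsel_index xA) index_uniq ?enum_uniq -?cardE.
Qed.

End Rank.

(** * From label sets to tableaux and back *)

Section Tableaux.
Variables (n : nat) (D : {set 'I_n * 'I_n}).
Implicit Types (c k : 'I_n) (b : box D) (T : {ffun box D -> 'I_n}) (alpha : 'X_{1..n}).

Definition column_boxes c : {set box D} := [set b | bcol b == c].

Lemma brow_inj c : {in column_boxes c &, injective (@brow n D)}.
Proof.
move=> b b'; rewrite !inE => /eqP Eb /eqP Eb' E; apply: val_inj.
by move: Eb Eb' E; rewrite /bcol /brow; case: (val b) (val b') => ? ? [? ?] /= -> -> ->.
Qed.

Lemma brow_column b : brow b \in column D (bcol b).
Proof. by rewrite inE -surjective_pairing; apply: valP. Qed.

Lemma nsel_column c (P : pred 'I_n) :
  nsel (column D c) P = #|[set b in column_boxes c | P (brow b)]|.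
Proof.
rewrite -(card_in_imset (f := @brow n D)); last first.
  by move=> b b' /setIdP[bc _] /setIdP[bc' _]; apply: brow_inj bc bc'.
apply: eq_card => p; rewrite inE; apply/andP/imsetP => [[pc Pp]|[b + ->]].
  have pcD : (p, c) \in D by rewrite inE in pc.
  by exists (Sub (p, c) pcD); rewrite // !inE /bcol /brow SubK /= eqxx.
by rewrite !inE => /andP[/eqP <- ->]; split=> //; have := brow_column b; rewrite inE.
Qed.

Lemma card_column c : #|column D c| = #|column_boxes c|.
Proof.
have <- : nsel (column D c) predT = #|column D c| by apply: eq_card => p; rewrite inE andbT.
by rewrite nsel_column; apply: eq_card => b; rewrite inE andbT.
Qed.

Definition column_distinct T := forall b b', bcol b = bcol b' -> T b = T b' -> b = b'.

Lemma card_content T k : column_distinct T ->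
  (#|[set b | T b == k]| = \sum_c (k \in T @: column_boxes c))%N.
Proof.
move=> injT; rewrite -sum1_card (partition_big (@bcol n D) predT) //=.
apply: eq_bigr => c _; case: imsetP => [[b0]|no].
  rewrite inE => /eqP Ec ->; rewrite (big_pred1 b0) // => b /=.
  rewrite !inE; apply/andP/eqP => [[/eqP ET /eqP Eb]|->]; last by rewrite Ec !eqxx.
  by apply: injT => //; rewrite Eb.
rewrite big_pred0 // => b; rewrite inE; apply/negP => /andP[/eqP ET Eb].
by apply: no; exists b; rewrite ?inE.
Qed.

Lemma PerfectTabP alpha T : reflect
  [/\ forall k, #|[set b | T b == k]| = alpha k, column_distinct T
     & forall b, (T b <= brow b)%N]
  (T \in PerfectTab D alpha).
Proof.
rewrite inE; apply: (iffP and3P) => -[H1 H2 H3]; split.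
- by move=> k; apply/eqP/(forallP H1).
- move=> b b' Ec ET; have /forallP/(_ b') := forallP H2 b.
  by rewrite Ec ET !eqxx /= implybF negbK => /eqP.
- exact/forallP.
- by apply/forallP => k; apply/eqP.
- apply/'forall_forallP => b b'; apply/implyP => /andP[/eqP Ec].
  by apply: contraNneq => /(H2 _ _ Ec) ->.
exact/forallP.
Qed.

Lemma card_labels T c : column_distinct T -> #|T @: column_boxes c| = #|column D c|.
Proof.
move=> injT; rewrite card_column card_in_imset // => b b'.
by rewrite !inE => /eqP Eb /eqP Eb'; apply: injT; rewrite Eb.
Qed.

Lemma PerfectTab_column_labels alpha T :
  T \in PerfectTab D alpha -> column_labels D alpha.
Proof.
move=> /PerfectTabP[Ea injT leT]; exists (fun c => T @: column_boxes c) => [c|k].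
  split=> [|t]; first exact: card_labels.
  rewrite nsel_column /nsel.
  apply: (@leq_trans #|T @: [set b in column_boxes c | (t <= brow b)%N]|).
    apply/subset_leq_card/subsetP => _ /setIdP[/imsetP[b bc ->] le].
    by apply: imset_f; rewrite inE bc (leq_trans le).
  exact: leq_imset_card.
by rewrite -Ea card_content.
Qed.

Lemma column_labels_PerfectTab_down alpha :
  column_labels D alpha -> PerfectTab_down D alpha != set0.
Proof.
case=> B FB EB.
(* Each box receives the label whose rank in the label set equals the rank of its row in the
   column. *)
have labelP b : exists2 x, x \in B (bcol b) &
    nsel (B (bcol b)) (fun y => y < x)%N = nsel (column D (bcol b)) (fun p => p < brow b)%N.
  apply: nsel_ltn_index; rewrite (FB _).1 (nsel_compl (column D (bcol b)) (brow b)).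
  rewrite -[X in (X < _)%N]add0n ltn_add2r; apply/card_gt0P; exists (brow b).
  by rewrite inE brow_column /=.
have [f fB fE] := fin_all_exists2 labelP; pose T := [ffun b => f b].
have [TB TE] : (forall b, T b \in B (bcol b)) /\ forall b,
    nsel (B (bcol b)) (fun y => y < T b)%N = nsel (column D (bcol b)) (fun p => p < brow b)%N.
  by split=> b; rewrite ffunE.
have mono b b' : bcol b = bcol b' -> (brow b < brow b')%N -> (T b < T b')%N.
  move=> Ec lt; rewrite ltnNge; apply/negP => le.
  have := nsel_lt (brow_column b) lt; rewrite -TE {2}Ec -TE -Ec ltnNge.
  by case/negP; apply: nsel_sub => y -> ltb; rewrite (leq_trans ltb le).
have injT : column_distinct T.
  move=> b b' Ec ET; apply: (@brow_inj (bcol b)); rewrite ?inE ?Ec //.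
  apply: val_inj; case: (ltngtP (brow b) (brow b')) => // lt.
    by have := mono _ _ Ec lt; rewrite ET ltnn.
  by have := mono _ _ (esym Ec) lt; rewrite ET ltnn.
apply/set0Pn; exists T; rewrite inE; apply/andP; split; last first.
  apply/'forall_forallP => b b'; apply/implyP => /andP[/eqP Ec]; exact: mono.
apply/PerfectTabP; split=> // [k|b].
  rewrite EB card_content //; apply: eq_bigr => c _.
  suff -> : T @: column_boxes c = B c by [].
  apply/eqP; rewrite eqEcard card_labels // (FB c).1 leqnn andbT.
  by apply/subsetP => _ /imsetP[b + ->]; rewrite inE => /eqP <-.
(* A label exceeding its row would leave fewer labels than rows up to that row, against domination
   at t = [(brow b).+1]. *)
rewrite leqNgt; apply/negP => lt.
have ltr := nsel_lt (brow_column b) (ltnSn (brow b)).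
have leB : (nsel (B (bcol b)) (fun y => y < (brow b).+1)
            <= nsel (B (bcol b)) (fun y => y < T b))%N.
  by apply: nsel_sub => y -> lty; apply: leq_trans lty lt.
have [E /(_ (brow b).+1)] := FB (bcol b); move: leB ltr E; rewrite TE.
rewrite (nsel_compl (B _) (brow b).+1) (nsel_compl (column D _) (brow b).+1).
by nlia.
Qed.

End Tableaux.

Theorem theorem1p3 (n : nat) (w : 'S_n) (alpha : 'X_{1..n}) :
  ((0 < (schubert w)@_alpha) <-> (PerfectTab (rothe w) alpha != set0)) /\
  ((PerfectTab (rothe w) alpha != set0) <->
     (PerfectTab_down (rothe w) alpha != set0)).
Proof.
have down : PerfectTab_down (rothe w) alpha != set0 -> PerfectTab (rothe w) alpha != set0.
  by case/set0Pn => T; rewrite inE => /andP[TP _]; apply/set0Pn; exists T.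
have perfect : PerfectTab (rothe w) alpha != set0 -> column_labels (rothe w) alpha.
  by case/set0Pn => T; apply: PerfectTab_column_labels.
suff gt0 : 0 < (schubert w)@_alpha <-> column_labels (rothe w) alpha.
  split; [rewrite gt0|]; split=> //.
    by move/column_labels_PerfectTab_down.
  by move=> /perfect/column_labels_PerfectTab_down.
(* The nilCoxeter argument is stated for ['S_n.+1]; the trivial group ['S_0] is settled by the
   formula at [w0]. *)
case: n w alpha {down perfect} => [|n] w alpha; last exact: schubert_gt0.
have -> : w = w0 by apply/permP; case.
rewrite column_labels_w0 schubert_w0 mcoeffX.
by split=> [_|->]; [apply/mnmP; case | rewrite eqxx].
Qed.
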